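(* Let $d\in\mathbb N$, let $\lambda_1,\dots,\lambda_d\in\mathbb C$ be the roots of an irreducible polynomial of degree $d$ with integer coefficients, and let $c_1,\dots,c_d\in\mathbb C$. Assume the dominant root condition: $\lambda_1$ is real, $\lambda_1>1$, $\lambda_1>\max\{|\lambda_2|,\dots,|\lambda_d|\}$, and $c_1\ne0$. Assume that $a_k=c_1\lambda_1^k+\dots+c_d\lambda_d^k$ is a positive integer for every $k\in\mathbb N$, and let $S_n(\omega)=\sum_{k=1}^n\cos(2\pi a_k\omega)$, $\omega\in[0,1]$, viewed as a random variable on $[0,1]$ with Lebesgue measure. Then for every $m\in\mathbb N$ there exist an integer $n_1(m)$ and integers $w_m,b_m\in\mathbb Z$, depending only on $m$ and on $c_1,\dots,c_d,\lambda_1,\dots,\lambda_d$, such that $$\kappa_m(S_n)=2^{-m}(w_m n+b_m)\qquad\text{for all } n>n_1(m).$$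
   Context: For a bounded random variable $X$, its $m$-th cumulant is $\kappa_m(X)=\frac{d^m}{dt^m}\log\mathbb E[e^{tX}]\big|_{t=0}$. *)

(* Defs.v *)
From HB Require Import structures.
From mathcomp Require Import all_boot all_order all_algebra.
From mathcomp Require Import all_classical all_reals all_analysis.
From mathcomp Require Import complex.
Set Implicit Arguments. Unset Strict Implicit. Unset Printing Implicit Defensive.
Import Order.TTheory GRing.Theory Num.Theory.
Local Open Scope ring_scope.
Local Open Scope classical_set_scope.

Definition unit_expect (R : realType) (X : R -> R) : R :=
  Rintegral (@lebesgue_measure R) `[0%R, 1%R] X.

Definition unit_mgf (R : realType) (X : R -> R) (t : R) : R :=
  unit_expect (fun w => expR (t * X w)).

Definition cumulant (R : realType) (m : nat) (X : R -> R) : R :=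
  derive1n m (fun t => ln (unit_mgf X t)) 0.

Definition Ssum (R : realType) (a : nat -> nat) (n : nat) (w : R) : R :=
  \sum_(1 <= k < n.+1) cos (2 * pi * (a k)%:R * w).

(* Main.v *)
(* Expanding 2 cos into exponentials, 2^m E[S_n^m] counts the words of length m in
   the letters (k, +-), 1 <= k <= n, whose signed sum of the a_k vanishes, and
   2^m kappa_m(S_n) is the sum over the same words of their joint cumulant, an
   integer.  A nonzero signed sum of m terms a_k with all k >= y has size at least
   delta_m lambda_1^y, so when the indices of a word leave a large gap, every
   vanishing subsum vanishes separately on both sides of the gap and the joint
   cumulant is zero.  Only words of bounded diameter remain.  For these, vanishing
   is invariant under index shifts far enough out: if the associated polynomial Q
   has Q(lambda_1) <> 0 the dominant root prevails, and otherwise irreducibility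
   gives Q(lambda_j) = 0 for all j.  Hence passing from n to n + 1 adds a constant. *)
Require Import Defs.
From HB Require Import structures.
From mathcomp Require Import all_boot all_order all_algebra.
From mathcomp Require Import all_classical all_reals all_analysis.
From mathcomp Require Import complex.
From mathcomp Require Import zify ring lra.
Set Implicit Arguments. Unset Strict Implicit. Unset Printing Implicit Defensive.
Import Order.TTheory GRing.Theory Num.Theory.
Import numFieldNormedType.Exports.
Local Open Scope ring_scope.

(** * Words and joint cumulants *)

Section BinomialConvolution.
Variable R : comPzRingType.
Implicit Types u v : nat -> R.

(* Equals [\sum_(j < m.+1) 'C(m, j) * u j * v (m - j)]; the recursion is the
   Leibniz rule, which is all that is used of it. *)
Fixpoint bconv (m : nat) u v : R :=
  if m is m'.+1 then bconv m' (u \o succn) v + bconv m' u (v \o succn)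
  else u 0%N * v 0%N.

Lemma eq_bconv m u u' v v' :
    (forall j, (j <= m)%N -> u j = u' j) ->
    (forall j, (j <= m)%N -> v j = v' j) ->
  bconv m u v = bconv m u' v'.
Proof.
elim: m u u' v v' => [|m IH] u u' v v' eu ev /=; first by rewrite eu ?ev.
by congr (_ + _); apply: IH => j jm /=; rewrite ?eu ?ev // (leq_trans jm).
Qed.

Lemma bconv_suml m (I : Type) (r : seq I) (F : I -> nat -> R) v :
  \sum_(i <- r) bconv m (F i) v = bconv m (fun j => \sum_(i <- r) F i j) v.
Proof.
elim: m F v => [|m IH] F v /=; first by rewrite mulr_suml.
by rewrite big_split /= -!IH.
Qed.

Lemma bconv_sumr m (I : Type) (r : seq I) u (F : I -> nat -> R) :
  \sum_(i <- r) bconv m u (F i) = bconv m u (fun j => \sum_(i <- r) F i j).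
Proof.
elim: m F u => [|m IH] F u /=; first by rewrite mulr_sumr.
by rewrite big_split /= -!IH.
Qed.

Lemma bconv_scale m (a b c : R) u v :
  bconv m (fun j => a * c ^+ j * u j) (fun j => b * c ^+ j * v j)
  = a * b * c ^+ m * bconv m u v.
Proof.
elim: m a b u v => [|m IH] a b u v /=; first by rewrite !expr0; ring.
rewrite mulrDr.
rewrite (@eq_bconv _ _ (fun j => (a * c) * c ^+ j * (u \o succn) j)
  _ (fun j => b * c ^+ j * v j)) //; last by move=> j _ /=; rewrite exprS; ring.
rewrite (@eq_bconv _ _ (fun j => a * c ^+ j * u j)
  (_ \o succn) (fun j => (b * c) * c ^+ j * (v \o succn) j)) //; last first.
  by move=> j _ /=; rewrite exprS; ring.
by rewrite !IH exprS; ring.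
Qed.

Lemma bconv_diff m u u' v : (forall j, (j < m)%N -> u j = u' j) ->
  bconv m u v - bconv m u' v = (u m - u' m) * v 0%N.
Proof.
elim: m u u' v => [|m IH] u u' v eu /=; first by rewrite mulrBl.
have -> : bconv m u (v \o succn) = bconv m u' (v \o succn) by apply: eq_bconv.
by rewrite opprD addrACA subrr addr0 IH // => j jm; apply: eu.
Qed.

(** Triangular inversion: [u m] enters [bconv m u v] only as [u m * v 0]. Thus a sequence is
    recognised as the cumulants once it satisfies the moment-cumulant recursion. *)
Lemma bconv_injl u u' v : v 0%N = 1 ->
  (forall m, bconv m u v = bconv m u' v) -> forall m, u m = u' m.
Proof.
move=> v0 E m; have [n] := ubnP m; elim: n m => // n IH m mn.
have := @bconv_diff m u u' v.
rewrite E subrr v0 mulr1 => /(_ _)/esym H; apply/eqP; rewrite -subr_eq0 H //.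
by move=> j jm; apply: IH; apply: leq_trans jm _.
Qed.

End BinomialConvolution.

Lemma rmorph_bconv (R S : comPzRingType) (h : {rmorphism R -> S}) m
    (u v : nat -> R) :
  h (bconv m u v) = bconv m (h \o u) (h \o v).
Proof.
by elim: m u v => [|m IH] u v /=; rewrite ?rmorphM // rmorphD !IH.
Qed.

Section Words.
Variables (R : comPzRingType) (T : eqType).
Implicit Types (f g z : seq T -> R) (s l r : seq T) (A : seq T).

(** Positions are distributed, not values, so repeated letters give repeated pairs. *)
Fixpoint splits s : seq (seq T * seq T) :=
  if s is x :: s' then
    [seq (x :: p.1, p.2) | p <- splits s'] ++
    [seq (p.1, x :: p.2) | p <- splits s']
  else [:: ([::], [::])].

Lemma sum_splits_cons (F : seq T -> seq T -> R) (P : pred (seq T * seq T)) x s :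
  \sum_(p <- splits (x :: s) | P p) F p.1 p.2 =
  \sum_(p <- splits s | P (x :: p.1, p.2)) F (x :: p.1) p.2 +
  \sum_(p <- splits s | P (p.1, x :: p.2)) F p.1 (x :: p.2).
Proof. by rewrite big_cat !big_map. Qed.

Lemma sum_splits_nilr (F : seq T -> seq T -> R) s :
  \sum_(p <- splits s | nilp p.2) F p.1 p.2 = F s [::].
Proof.
elim: s F => [|x s IH] F; first by rewrite big_cons big_nil addr0.
rewrite (sum_splits_cons _ (fun p => nilp p.2)) /= (IH (fun l => F (x :: l))).
by rewrite big_pred0_eq addr0.
Qed.

Lemma size_splits s p : p \in splits s -> (size p.1 + size p.2 = size s)%N.
Proof.
elim: s p => [|x s IH] p /=; first by rewrite inE => /eqP->.
by rewrite mem_cat => /orP[] /mapP[q /IH <- ->]; rewrite /= ?addnS.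
Qed.

Lemma size_splits_lt s p :
  p \in splits s -> ~~ nilp p.2 -> (size p.1 < size s)%N.
Proof.
by move=> /size_splits <-; rewrite /nilp -lt0n => p2; rewrite -addn1 leq_add2l.
Qed.

Lemma subseq_splits s p :
  p \in splits s -> subseq p.1 s /\ subseq p.2 s.
Proof.
elim: s p => [|x s IH] p; first by rewrite inE => /eqP->.
rewrite [splits _]/= mem_cat => /orP[] /mapP[q /IH[q1 q2] ->] /=.
  by rewrite eqxx; split=> //; apply: subseq_trans q2 (subseq_cons _ _).
by rewrite eqxx; split=> //; apply: subseq_trans q1 (subseq_cons _ _).
Qed.

(** The convolution dual to unshuffling; by [shuffle_cons], precomposition with [cons x] is a
    derivation for it. *)
Definition shuffle f g s : R := \sum_(p <- splits s) f p.1 * g p.2.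

Lemma shuffle_cons f g x s :
  shuffle f g (x :: s) = shuffle (f \o cons x) g s + shuffle f (g \o cons x) s.
Proof. by rewrite /shuffle (sum_splits_cons (fun l r => f l * g r) predT). Qed.

Fixpoint words A m : seq (seq T) :=
  if m is m'.+1 then [seq x :: s | x <- A, s <- words A m'] else [:: [::]].

Lemma mem_words A m s : (s \in words A m) = (size s == m) && all [in A] s.
Proof.
elim: m s => [|m IH] s /=; first by rewrite inE; case: s.
apply/allpairsP/idP => [[[x t] /= [xA tw ->]]|].
  by move: tw; rewrite IH /= eqSS => /andP[-> ->]; rewrite xA.
case: s => // x s /=; rewrite eqSS => /and3P[sm xA sA].
by exists (x, s); split; rewrite // IH sm.
Qed.

Lemma words_uniq A m : uniq A -> uniq (words A m).
Proof.
move=> uA; elim: m => // m IH /=; apply: allpairs_uniq => //.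
by move=> [x s] [y t] _ _ /= [-> ->].
Qed.

Definition wsum A m f : R := \sum_(s <- words A m) f s.

Lemma wsumS A m f : wsum A m.+1 f = \sum_(x <- A) wsum A m (f \o cons x).
Proof. by rewrite /wsum /= big_allpairs_dep. Qed.

(** Choosing [j] of the [m] positions and filling both parts independently produces the binomial
    coefficients; the proof only matches the two Leibniz rules. *)
Lemma wsum_shuffle A m f g :
  wsum A m (shuffle f g) = bconv m (wsum A ^~ f) (wsum A ^~ g).
Proof.
elim: m f g => [|m IH] f g.
  by rewrite /wsum /shuffle /= !big_cons !big_nil !addr0.
rewrite wsumS /=.
under eq_bigr => x _.
  rewrite (_ : wsum _ _ _ = wsum A m (shuffle (f \o cons x) g)
    + wsum A m (shuffle f (g \o cons x))); first by rewrite !IH over.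
  rewrite /wsum -big_split; apply: eq_bigr => s _; exact: shuffle_cons.
rewrite big_split bconv_suml bconv_sumr.
by congr (_ + _); apply: eq_bconv => j _ /=; rewrite ?wsumS.
Qed.

(** The counter is fuel, as [x :: p.1] is no structural subterm of [s]. Here [x :: p.1] is the block
    that contains the first letter; the terms in which it is not all of [s] are subtracted. *)
Fixpoint wcum_rec n z s : R :=
  match n, s with
  | n'.+1, x :: s' => z s -
      \sum_(p <- splits s' | ~~ nilp p.2) wcum_rec n' z (x :: p.1) * z p.2
  | _, _ => 0
  end.

(* The logarithm of [z] for the shuffle product, characterised by
   [shuffle_wcum]; when [z] maps a word to the expectation of the product of its
   letters, [wcum z] is the joint cumulant. *)
Definition wcum z s := wcum_rec (size s) z s.

Lemma wcum_rec_fuel z n s : (size s <= n)%N -> wcum_rec n z s = wcum z s.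
Proof.
rewrite /wcum; have [k] := ubnP (size s).
elim: k n s => // k IH [|n] [|x s] //=; rewrite !ltnS => sk sn.
congr (_ - _); rewrite big_seq_cond [in RHS]big_seq_cond.
apply: eq_bigr => p /andP[ps /(size_splits_lt ps) p1].
by rewrite (IH n) ?(IH (size s)) //= ?(leq_ltn_trans p1) ?(leq_trans p1).
Qed.

Lemma wcum_cons z x s : wcum z (x :: s) = z (x :: s) -
  \sum_(p <- splits s | ~~ nilp p.2) wcum z (x :: p.1) * z p.2.
Proof.
rewrite {1}/wcum /=; congr (_ - _).
rewrite big_seq_cond [in RHS]big_seq_cond.
apply: eq_bigr => p /andP[ps /(size_splits_lt ps) p1].
by rewrite wcum_rec_fuel.
Qed.

(** The split with [p.2] empty gives [wcum z (x :: s)] itself; the recursion subtracts exactly the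
    others. *)
Lemma shuffle_wcum z x s : z [::] = 1 ->
  shuffle (wcum z \o cons x) z s = z (x :: s).
Proof.
move=> z0; rewrite /shuffle (bigID (fun p => nilp p.2)) /=.
rewrite (sum_splits_nilr (fun l r => wcum z (x :: l) * z r)) z0 mulr1.
by rewrite wcum_cons subrK.
Qed.

(** Summation over all words turns the block recursion into a scalar one, of the same form as
    [moment_cumulant]. *)
Lemma wsum_wcum A z m : z [::] = 1 ->
  wsum A m.+1 z = bconv m (fun j => wsum A j.+1 (wcum z)) (wsum A ^~ z).
Proof.
move=> z0; rewrite wsumS.
under eq_bigr => x _.
  rewrite (_ : wsum _ _ _ = wsum A m (shuffle (wcum z \o cons x) z)); last first.
    by apply: eq_bigr => s _; rewrite /= shuffle_wcum.
  rewrite wsum_shuffle; over.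
by rewrite bconv_suml; apply: eq_bconv => // j _; rewrite wsumS.
Qed.

(** Letters outside [P] are forced into the right part, so only the letters in [P] remain to be
    distributed. *)
Lemma sum_splits_filter (P : pred T) (F : seq T -> seq T -> seq T -> R) s :
  \sum_(p <- splits s | all P p.1)
     F p.1 (seq.filter P p.2) (seq.filter (predC P) p.2)
  = \sum_(p <- splits (seq.filter P s)) F p.1 p.2 (seq.filter (predC P) s).
Proof.
elim: s F => [|x s IH] F; first by rewrite !big_cons !big_nil.
rewrite (sum_splits_cons
  (fun l r => F l (seq.filter P r) (seq.filter (predC P) r)) (fun p => all P p.1)) /=.
case: (boolP (P x)) => Px /=.
  rewrite (sum_splits_cons (fun l r => F l r (seq.filter (predC P) s)) predT).
  rewrite (IH (fun l r t => F (x :: l) r t)).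
  by rewrite (IH (fun l r t => F l (x :: r) t)).
rewrite big_pred0_eq add0r.
by rewrite (IH (fun l r t => F l r (x :: t))).
Qed.

(* In the recursion for [wcum z s], the subwords that meet both classes of [P]
   contribute [0] by induction; the others add up to the recursion for the part of
   [s] in the class of its first letter, times [z] of the remaining part. *)
Lemma wcum_split0 (P : pred T) z s : z [::] = 1 ->
    (forall t, subseq t s ->
       z t = z (seq.filter P t) * z (seq.filter (predC P) t)) ->
    has P s -> has (predC P) s -> wcum z s = 0.
Proof.
move=> z0; have [n] := ubnP (size s).
elim: n P s => // n IH P [|x s] //; rewrite ltnS => sn zM.
(* The hypotheses are symmetric in [P] and its complement, so the first letter may be assumed to
   satisfy [P]. *)
wlog Px : P zM / P x => [wl|].
  case: (boolP (P x)) => [Px|nPx]; first exact: wl.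
  move=> hP hC; apply: (wl (predC P)) => // [t /zM->|].
    rewrite mulrC; congr (_ * z _); apply: eq_filter => y /=; exact/esym/negbK.
  by rewrite -(eq_has (a1 := P)) // => y /=; rewrite negbK.
move=> _ /= /orP[/negP[] //|hC].
rewrite wcum_cons; apply/eqP; rewrite subr_eq0; apply/eqP.
rewrite (zM _ (subseq_refl _)) /= Px /=.
rewrite -[z (x :: _)]shuffle_wcum // /shuffle big_distrl /=.
rewrite -(sum_splits_filter P
  (fun l r t => wcum z (x :: l) * z r * z t)).
rewrite [RHS](bigID (fun p => all P p.1)) /= [X in _ = _ + X]big1_seq ?addr0.
  rewrite big_seq_cond [RHS]big_seq_cond.
  (* The condition that [p.2] is nonempty is automatic here: [s] has a letter outside [P], and it
     cannot go into [p.1]. *)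
  apply: congr_big => // [p|p /andP[ps _]].
    case: (boolP (p \in splits s)) => //= ps.
    case: (boolP (all P p.1)) => //= [aP|]; last by rewrite andbF.
    rewrite andbT; apply/esym; apply/negP => /nilP p20.
    have := size_splits ps; have [p1s _] := subseq_splits ps.
    rewrite p20 addn0 => /esym sp.
    have E : p.1 = s by apply/eqP; rewrite -(size_subseq_leqif p1s) sp.
    by move: hC; rewrite -E has_predC aP.
  rewrite -mulrA -zM //; apply: subseq_trans (subseq_cons _ _).
  by case: (subseq_splits ps).
move=> p /andP[/andP[p2 nP] ps].
have [p1s p2s] := subseq_splits ps.
rewrite (IH P (x :: p.1)) ?mul0r //.
- exact: leq_ltn_trans (size_splits_lt ps p2) sn.
- by move=> t ts; apply: zM; apply: (subseq_trans ts); rewrite /= eqxx.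
- by rewrite /= Px.
- by rewrite /= has_predC nP orbT.
Qed.

Lemma eq_wcum z z' s : (forall t, subseq t s -> z t = z' t) ->
  wcum z s = wcum z' s.
Proof.
have [n] := ubnP (size s); elim: n s => // n IH [|x s] //; rewrite ltnS => sn E.
rewrite !wcum_cons E //; congr (_ - _); rewrite big_seq_cond [in RHS]big_seq_cond.
apply: eq_bigr => p /andP[ps p2]; have [p1s p2s] := subseq_splits ps.
rewrite E; last exact: subseq_trans p2s (subseq_cons _ _).
rewrite IH // => [|t ts].
  exact: leq_ltn_trans (size_splits_lt ps p2) sn.
by apply: E; apply: (subseq_trans ts); rewrite /= eqxx.
Qed.

End Words.

Lemma splits_map (T U : eqType) (h : T -> U) s :
  splits (map h s) = [seq (map h p.1, map h p.2) | p <- splits s].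
Proof.
elim: s => //= x s ->; rewrite map_cat -!map_comp.
by congr (_ ++ _); apply: eq_map.
Qed.

Lemma wcum_map (R : comPzRingType) (T U : eqType) (h : T -> U)
    (z : seq U -> R) s :
  wcum z (map h s) = wcum (z \o map h) s.
Proof.
have [n] := ubnP (size s); elim: n s => // n IH [|x s] //; rewrite ltnS => sn.
rewrite /= !wcum_cons /= splits_map big_map; congr (_ - _).
rewrite big_seq_cond [in RHS]big_seq_cond; apply: eq_big => [p|p].
  by rewrite /nilp size_map.
rewrite /nilp /= size_map => /andP[ps p2]; rewrite -map_cons IH //.
exact: leq_ltn_trans (size_splits_lt ps p2) sn.
Qed.

(** * Cumulants of cosine sums *)

Section IteratedDerivatives.
Local Open Scope classical_set_scope.
Variable R : realType.
Implicit Types f g : R -> R.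

(** Derivability is asked at every point, so that the rules for [derive1] are equalities of
    functions and can be differentiated again. *)
Fixpoint nderivable (n : nat) f : Prop :=
  if n is n'.+1 then (forall t, derivable f t 1) /\ nderivable n' (derive1 f)
  else True.

Lemma nderivableW n f : nderivable n.+1 f -> nderivable n f.
Proof. by elim: n f => // n IH f [df /IH]. Qed.

Lemma derive1D f g : (forall t, derivable f t 1) -> (forall t, derivable g t 1) ->
  derive1 (f + g) = derive1 f + derive1 g.
Proof.
by move=> df dg; apply/funext => t; rewrite derive1E deriveD // !fctE !derive1E.
Qed.

Lemma derive1_mul f g : (forall t, derivable f t 1) -> (forall t, derivable g t 1) ->
  derive1 (f * g) = derive1 f * g + f * derive1 g.
Proof.
move=> df dg; apply/funext => t; rewrite derive1E deriveM // !fctE !derive1E.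
by rewrite addrC /GRing.scale /= [g t * _]mulrC.
Qed.

Lemma derive1_inv f : (forall t, derivable f t 1) -> (forall t, f t != 0) ->
  derive1 (fun t => (f t)^-1) =
  (fun t => (f t)^-1) * ((fun t => (f t)^-1) * (cst (-1) * derive1 f)).
Proof.
move=> df f0; apply/funext => t.
rewrite derive1E deriveV // !fctE !derive1E /GRing.scale /= /cst.
by field; exact: f0.
Qed.

Lemma nderivableD n f g :
  nderivable n f -> nderivable n g -> nderivable n (f + g).
Proof.
elim: n f g => // n IH f g [df nf] [dg ng]; split=> [t|].
  exact: derivableD.
by rewrite derive1D //; apply: IH.
Qed.

Lemma nderivableM n f g :
  nderivable n f -> nderivable n g -> nderivable n (f * g).
Proof.
elim: n f g => // n IH f g [df nf] [dg ng]; split=> [t|].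
  exact: derivableM.
rewrite derive1_mul //; apply: nderivableD; apply: IH => //;
  by apply: nderivableW; split.
Qed.

Lemma nderivable_cst n (c : R) : nderivable n (cst c).
Proof.
elim: n c => // n IH c; split=> [t|]; first exact: derivable_cst.
by rewrite (_ : derive1 _ = cst 0) //; apply/funext => t; rewrite derive1_cst.
Qed.

Lemma nderivableV n f : (forall t, f t != 0) ->
  nderivable n f -> nderivable n (fun t => (f t)^-1).
Proof.
move=> f0; elim: n => // n IH [df nf]; split=> [t|].
  by apply: derivableV.
have nI := IH (nderivableW (conj df nf)).
by rewrite derive1_inv //; do !apply: nderivableM => //; apply: nderivable_cst.
Qed.

Lemma derive1nD n f g : nderivable n f -> nderivable n g ->
  derive1n n (f + g) = derive1n n f + derive1n n g.
Proof.
elim: n f g => // n IH f g [df nf] [dg ng].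
by rewrite !derive1Sn derive1D // IH.
Qed.

Lemma derive1n_mul n f g t : nderivable n f -> nderivable n g ->
  derive1n n (f * g) t = bconv n (fun j => derive1n j f t) (fun j => derive1n j g t).
Proof.
elim: n f g => // n IH f g nf ng; have [df nf'] := nf; have [dg ng'] := ng.
have {}nf := nderivableW nf; have {}ng := nderivableW ng.
rewrite derive1Sn derive1_mul // derive1nD; do ?exact: nderivableM.
rewrite fctE !IH //=; congr (_ + _); apply: eq_bconv => // j _;
  by rewrite -[RHS]/(derive1n j.+1 _ t) derive1Sn.
Qed.

End IteratedDerivatives.

Notation word := (seq (nat * bool)).

(* The letter [(k, e)] stands for the frequency [+a_k] or [-a_k] in
   [2 cos (2 pi a_k w) = exp (2 pi i a_k w) + exp (- 2 pi i a_k w)]. *)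
Definition letters (n : nat) : word :=
  [seq (k, e) | k <- index_iota 1 n.+1, e <- [:: true; false]].

Definition letter_val (a : nat -> nat) (x : nat * bool) : int :=
  if x.2 then (a x.1)%:Z else - (a x.1)%:Z.

Definition word_val (a : nat -> nat) (s : word) : int :=
  \sum_(x <- s) letter_val a x.

(** By orthogonality, this is the expectation of the product of the exponentials attached to the
    letters. Taken in [int], it makes every [wcum (zero_sum a) s] an integer. *)
Definition zero_sum (a : nat -> nat) (s : word) : int := (word_val a s == 0)%:R.

Lemma zero_sum_nil (a : nat -> nat) : zero_sum a [::] = 1.
Proof. by rewrite /zero_sum /word_val big_nil eqxx. Qed.

(** * Integrals, moments and cumulants on the unit interval *)

Section UnitInterval.
Local Open Scope classical_set_scope.
Variable R : realType.
Implicit Types f X : R -> R.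
Local Notation mu := (@lebesgue_measure R).
Local Notation I01 := (`[0%R, 1%R]%classic : set R).

Lemma continuous_integrable01 f : continuous f -> mu.-integrable I01 (EFin \o f).
Proof.
move=> cf; apply: (@continuous_compact_integrable R); first exact: segment_compact.
by apply: continuous_subspaceT => x; apply: cf.
Qed.

Lemma unit_expect_cst (c : R) : unit_expect (fun=> c) = c.
Proof.
rewrite /unit_expect Rintegral_cst //= lebesgue_measure_itv /= lte01.
by rewrite oppr0 adde0 mulr1.
Qed.

Lemma continuous_sum (J : Type) (r : seq J) (F : J -> R -> R) :
  (forall j, continuous (F j)) -> continuous (fun w => \sum_(j <- r) F j w).
Proof.
move=> cF; elim: r => [|j r IH] w.
  by under eq_fun do rewrite big_nil; exact: cvg_cst.
under eq_fun do rewrite big_cons.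
by apply: cvgD; [exact: cF | exact: IH].
Qed.

Lemma continuous_cos_mull (k : R) : continuous (fun w => cos (k * w)).
Proof.
move=> w; apply: (@continuous_comp _ _ _ (fun w => k * w) cos).
  by apply: cvgM; [exact: cvg_cst | exact: cvg_id].
exact: continuous_cos.
Qed.

Lemma unit_expect_sum (J : Type) (r : seq J) (F : J -> R -> R) :
  (forall j, continuous (F j)) ->
  unit_expect (fun w => \sum_(j <- r) F j w) = \sum_(j <- r) unit_expect (F j).
Proof.
move=> cF; elim: r => [|j r IH].
  by under eq_fun do rewrite big_nil; rewrite big_nil unit_expect_cst.
under eq_fun do rewrite big_cons.
rewrite big_cons -IH /unit_expect RintegralD //.
- exact: continuous_integrable01.
- exact/continuous_integrable01/continuous_sum.
Qed.

Lemma sin_2piz (q : int) : sin (2 * pi * q%:~R : R) = 0.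
Proof.
have H n : sin (2 * pi * n%:R : R) = 0.
  by have := periodicn (@sinD2pi R) n 0; rewrite add0r sin0 => <-; congr sin; ring.
by case: q => n; [exact: H | rewrite NegzE rmorphN /= mulrN sinN H oppr0].
Qed.

Lemma is_derive_mull (k x : R) : is_derive x 1 (fun w => k * w) k.
Proof.
rewrite -[X in is_derive _ _ _ X](mulr1 k).
exact: (@is_deriveZ _ _ _ id k x 1 1).
Qed.

Lemma unit_expect_cos (q : int) :
  unit_expect (fun w : R => cos (2 * pi * q%:~R * w)) = (q == 0)%:R.
Proof.
have [->|q0] := eqVneq q 0.
  under eq_fun do rewrite mulr0 mul0r cos0.
  exact: unit_expect_cst.
set k : R := 2 * pi * q%:~R.
have k0 : k != 0 by rewrite !mulf_neq0 ?pnatr_eq0 ?intr_eq0 // gt_eqF // pi_gt0.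
have dF (x : R) : is_derive x 1 (fun w => k^-1 * sin (k * w)) (cos (k * x)).
  have -> : cos (k * x) = k^-1 *: (k *: cos (k * x)).
    by rewrite /GRing.scale /= mulrA mulVf ?mul1r.
  apply: is_deriveZ.
  rewrite [k *: _]mulrC.
  exact: (is_derive1_comp (is_derive_sin (k * x)) (is_derive_mull k x)).
have cF : continuous (fun w => k^-1 * sin (k * w)).
  by move=> x; apply/differentiable_continuous/derivable1_diffP; case: (dF x).
rewrite /unit_expect /Rintegral.
rewrite (@continuous_FTC2 _ _ (fun w => k^-1 * sin (k * w))) //=.
- rewrite mulr0 sin0 mulr0 subr0 mulr1.
  by rewrite sin_2piz mulr0.
- exact/continuous_subspaceT/continuous_cos_mull.
- split.
  + by move=> x _; case: (dF x).
  + exact/cvg_at_right_filter/cF.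
  + exact/cvg_at_left_filter/cF.
- by move=> x _; rewrite derive1E; case: (dF x).
Qed.

Section Moments.
Variable X : R -> R.
Hypothesis cX : continuous X.

(** The [j]-th derivative of the moment generating function; the family is closed under
    differentiation. *)
Definition tilted_moment (j : nat) (t : R) : R :=
  unit_expect (fun w => X w ^+ j * expR (t * X w)).

Let continuous_tilted j t : continuous (fun w => X w ^+ j * expR (t * X w)).
Proof.
move=> w; apply: cvgM.
  apply: (@continuous_comp _ _ _ X (fun x => x ^+ j)); first exact: cX.
  exact: exprn_continuous.
apply: (@continuous_comp _ _ _ (fun w => t * X w) expR); last first.
  exact: continuous_expR.
by apply: cvgM; [exact: cvg_cst | exact: cX].
Qed.

Lemma is_derive_tilted_moment (j : nat) (t : R) :
  is_derive t 1 (tilted_moment j) (tilted_moment j.+1 t).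
Proof.
pose f (s : R) (w : R) := X w ^+ j * expR (s * X w).
have df (s w : R) : is_derive s 1 (f ^~ w) (X w ^+ j.+1 * expR (s * X w)).
  have -> : X w ^+ j.+1 * expR (s * X w) = X w ^+ j *: (expR (s * X w) * X w).
    by rewrite /GRing.scale /= exprSr -mulrA [X w * _]mulrC.
  apply: is_deriveZ; apply: (@is_derive1_comp _ expR (fun s => s * X w)).
  by under eq_fun do rewrite mulrC; exact: is_derive_mull.
have d1 s w : partial1of2 f s w = X w ^+ j.+1 * expR (s * X w).
  by rewrite partial1of2E; case: (df s w).
(* For $|s-t|<1$ one has $|s|\le|t|+1$, so [G] dominates the derivative in [s] uniformly; being
   continuous, it is integrable. *)
pose G w := `|X w| ^+ j.+1 * expR ((`|t| + 1) * `|X w|).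
have H1 : `]t - 1, t + 1[%classic t by rewrite /= in_itv /=; apply/andP; split; lra.
have H2 s : `]t - 1, t + 1[%classic s -> mu.-integrable I01 (EFin \o f s).
  by move=> _; apply: continuous_integrable01; apply: continuous_tilted.
have H3 (s w : R) : `]t - 1, t + 1[%classic s -> I01 w -> derivable (f ^~ w) s 1.
  by move=> _ _; case: (df s w).
have H4 w : 0 <= G w by rewrite mulr_ge0 ?exprn_ge0 // expR_ge0.
have H5 : mu.-integrable I01 (EFin \o G).
  apply: continuous_integrable01 => w; apply: cvgM.
    apply: (@continuous_comp _ _ _ (fun w => `|X w|) (fun x => x ^+ j.+1)).
      by apply: cvg_norm; exact: cX.
    exact: exprn_continuous.
  apply: (@continuous_comp _ _ _ (fun w => (`|t| + 1) * `|X w|) expR); last first.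
    exact: continuous_expR.
  by apply: cvgM; [exact: cvg_cst | apply: cvg_norm; exact: cX].
have H6 s w : `]t - 1, t + 1[%classic s -> I01 w -> `|partial1of2 f s w| <= G w.
  rewrite /= in_itv /= => /andP[s1 s2] _.
  rewrite d1 normrM normrX ler_wpM2l ?exprn_ge0 // ger0_norm ?expR_ge0 // ler_expR.
  apply: le_trans (ler_norm _) _; rewrite normrM ler_wpM2r //.
  rewrite ler_norml; have := ler_norm t; have := ler_norm (- t); rewrite normrN.
  by move=> *; apply/andP; split; lra.
have mI : measurable (I01 : set (measurableTypeR R)) by exact: measurable_itv.
split; first exact: (derivable_under_integral mI H1 H2 H3 H4 H5 H6).
rewrite -derive1E.
have := differentiation_under_integral mI H1 H2 H3 H4 H5 H6.
rewrite /tilted_moment /unit_expect => ->.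
by apply: eq_Rintegral => w _; rewrite -d1.
Qed.

Lemma unit_mgfE : unit_mgf X = tilted_moment 0.
Proof.
apply/funext => t; rewrite /unit_mgf /tilted_moment; congr unit_expect.
by apply/funext => w; rewrite expr0 mul1r.
Qed.

Lemma derive1n_tilted_moment m j : derive1n m (tilted_moment j) = tilted_moment (j + m).
Proof.
elim: m j => [|m IH] j; first by rewrite addn0.
rewrite derive1Sn (_ : derive1 _ = tilted_moment j.+1) ?IH ?addSnnS //.
by apply/funext => t; rewrite derive1E; case: (is_derive_tilted_moment j t).
Qed.

Lemma nderivable_tilted_moment m j : nderivable m (tilted_moment j).
Proof.
elim: m j => //= m IH j; split=> [t|]; first by case: (is_derive_tilted_moment j t).
by have := derive1n_tilted_moment 1 j; rewrite derive1n1 addn1 => ->.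
Qed.

Lemma tilted_moment_at0 j : tilted_moment j 0 = unit_expect (fun w => X w ^+ j).
Proof.
rewrite /tilted_moment; congr unit_expect; apply/funext => w.
by rewrite mul0r expR0 mulr1.
Qed.

(** The continuous integrand attains a positive minimum on $[0,1]$, which has mass 1. *)
Lemma unit_mgf_gt0 t : 0 < unit_mgf X t.
Proof.
have cf : continuous (fun w => expR (t * X w)).
  move=> x; have := @continuous_tilted 0 t x.
  by under eq_fun do rewrite expr0 mul1r.
have [|w0 _ w0P] := @EVT_min R (fun w => expR (t * X w)) 0 1 ler01.
  exact: continuous_subspaceT.
apply: (@lt_le_trans _ _ (expR (t * X w0))); first exact: expR_gt0.
rewrite -[leLHS]unit_expect_cst /unit_mgf /unit_expect; apply: le_Rintegral => //.
- by apply: continuous_integrable01 => x; exact: cvg_cst.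
- exact: continuous_integrable01.
Qed.

(** With $M$ the moment generating function, $M'=(\log M)'M$; the Leibniz rule differentiates this
    [m] times at 0. *)
Lemma moment_cumulant m :
  unit_expect (fun w => X w ^+ m.+1) =
  bconv m (fun j => cumulant j.+1 X) (fun j => unit_expect (fun w => X w ^+ j)).
Proof.
have Mgt0 t : 0 < tilted_moment 0 t by rewrite -unit_mgfE unit_mgf_gt0.
have Mneq0 t : tilted_moment 0 t != 0 by rewrite gt_eqF.
pose G := tilted_moment 1 * (fun t => (tilted_moment 0 t)^-1).
have lnE : derive1 (fun t => ln (unit_mgf X t)) = G.
  apply/funext => t; rewrite unit_mgfE derive1E.
  have [] // : is_derive t 1 (fun t => ln (tilted_moment 0 t)) (G t).
  rewrite /G fctE mulrC; apply: (@is_derive1_comp _ (@ln R)).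
    exact: is_derive1_ln.
  exact: is_derive_tilted_moment.
have GM : G * tilted_moment 0 = tilted_moment 1.
  by apply/funext => t; rewrite /G !fctE mulfVK.
have nG : nderivable m G.
  apply: nderivableM; first exact: nderivable_tilted_moment.
  by apply: nderivableV => //; exact: nderivable_tilted_moment.
rewrite -tilted_moment_at0 -(add1n m) -derive1n_tilted_moment -GM.
rewrite derive1n_mul //; last exact: nderivable_tilted_moment.
apply: eq_bconv => j _; last by rewrite derive1n_tilted_moment tilted_moment_at0.
by rewrite /cumulant derive1Sn lnE.
Qed.

Lemma cumulant0 : cumulant 0 X = 0.
Proof.
rewrite /cumulant /= unit_mgfE tilted_moment_at0.
by under eq_fun do rewrite expr0; rewrite unit_expect_cst ln1.
Qed.

End Moments.

(** * Moments and cumulants of the cosine sums as sums over words *)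

Section CosineSums.
Variable a : nat -> nat.

(** The phase [B] carries the induction: $2\cos\theta\cos B=\cos(B+\theta)+\cos(B-\theta)$, and each
    new letter is absorbed into the phase. *)
Lemma expr_Ssum n m (B w : R) :
  (2 * Ssum a n w) ^+ m * cos B =
  wsum (letters n) m (fun s => cos (2 * pi * (word_val a s)%:~R * w + B)).
Proof.
elim: m B => [|m IH] B.
  by rewrite /wsum /= big_seq1 /word_val big_nil mulr0 mul0r add0r mul1r.
rewrite wsumS.
transitivity (\sum_(x <- letters n)
    (2 * Ssum a n w) ^+ m * cos (2 * pi * (letter_val a x)%:~R * w + B)); last first.
  apply: eq_bigr => x _; rewrite IH; apply: eq_bigr => s _ /=; congr cos.
  by rewrite /word_val big_cons rmorphD /=; ring.
rewrite -mulr_sumr exprSr -mulrA; congr (_ * _).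
rewrite /letters big_allpairs_dep /Ssum mulr_sumr mulr_suml.
apply: eq_bigr => k _; rewrite big_cons big_seq1 /letter_val /=.
rewrite rmorphN /= mulrN mulNr !cosD cosN sinN; ring.
Qed.

Lemma moment_Ssum n m :
  unit_expect (fun w : R => Ssum a n w ^+ m) =
  2 ^- m * (wsum (letters n) m (zero_sum a))%:~R.
Proof.
transitivity (unit_expect (fun w : R => \sum_(s <- words (letters n) m)
    (2 ^- m * cos (2 * pi * (word_val a s)%:~R * w)))).
  congr unit_expect; apply/funext => w; rewrite -mulr_sumr.
  have := expr_Ssum n m 0 w; rewrite cos0 mulr1 /wsum.
  under eq_bigr do rewrite addr0.
  by move=> <-; rewrite exprMn mulrA mulVf ?mul1r // expf_neq0 // pnatr_eq0.
rewrite unit_expect_sum; last first.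
  by move=> s w; apply: cvgM; [exact: cvg_cst | exact: continuous_cos_mull].
rewrite /wsum rmorph_sum /= mulr_sumr; apply: eq_bigr => s _.
rewrite /unit_expect RintegralZl //; last first.
  exact/continuous_integrable01/continuous_cos_mull.
by rewrite -[Rintegral _ _ _]/(unit_expect _) unit_expect_cos /zero_sum; case: eqP.
Qed.

Lemma continuous_Ssum n : continuous (Ssum (R := R) a n).
Proof. by apply: continuous_sum => k; exact: continuous_cos_mull. Qed.

(** Both sides satisfy the moment-cumulant recursion with the same moments, so [bconv_injl]
    identifies them. *)
Lemma cumulant_Ssum n m :
  cumulant m.+1 (Ssum (R := R) a n) =
  2 ^- m.+1 * (wsum (letters n) m.+1 (wcum (zero_sum a)))%:~R.
Proof.
pose N j := wsum (letters n) j (zero_sum a).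
have z0 := zero_sum_nil a.
have N0 : N 0%N = 1 by rewrite /N /wsum /= big_cons big_nil z0 addr0.
apply: (@bconv_injl _ (fun m => cumulant m.+1 (Ssum a n))
  (fun m => 2 ^- m.+1 * (wsum (letters n) m.+1 (wcum (zero_sum a)))%:~R)
  (fun j => 2 ^- j * (N j)%:~R)) => [|k]; first by rewrite N0 expr0 invr1 mulr1.
transitivity (unit_expect (fun w : R => Ssum a n w ^+ k.+1)).
  rewrite moment_cumulant; last exact: continuous_Ssum.
  by apply: eq_bconv => // j _; rewrite moment_Ssum.
rewrite moment_Ssum wsum_wcum // rmorph_bconv.
rewrite [RHS](@eq_bconv _ _ _
  (fun j => 2^-1 * 2^-1 ^+ j * (wsum (letters n) j.+1 (wcum (zero_sum a)))%:~R)
  _ (fun j => 1 * 2^-1 ^+ j * (N j)%:~R)).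
- rewrite bconv_scale; congr (_ * _).
  by rewrite mulr1 -exprS exprVn.
- by move=> j _; rewrite -exprS exprVn.
- by move=> j _; rewrite mul1r exprVn.
Qed.

End CosineSums.
End UnitInterval.

(** * Vanishing signed sums *)

Definition word_shift (k : nat) : word -> word := map (fun x => ((k + x.1)%N, x.2)).

(** If the window $(y,y+L]$ contains an index, the letters up to [y + L] are discarded and the
    search goes on from [y + L]. Each move costs a letter, so there are at most [size s] moves. An
    empty window is a gap unless nothing lies above it. *)
Lemma word_gap (s : word) (y L : nat) :
  all (fun x => x.1 <= y + size s * L)%N s \/
  exists x0, [/\ (y <= x0)%N,
    all (fun x => (x.1 <= x0) || (x0 + L < x.1))%N s &
    has (fun x => x0 + L < x.1)%N s].
Proof.
have [n] := ubnP (size s); elim: n s y => // n IH s y; rewrite ltnS => sn.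
case: (boolP (has (fun x => y < x.1 <= y + L)%N s)) => [hs|/hasPn nh].
  pose s' := [seq x <- s | (y + L < x.1)%N].
  have ss' : (size s' < size s)%N.
    rewrite size_filter -(count_predC (fun x => y + L < x.1)%N s).
    rewrite -[ltnLHS]addn0 ltn_add2l -has_count.
    by apply: sub_has hs => x /= /andP[_]; rewrite leqNgt.
  have [|/allP H|[x0 [yx /allP A B]]] := IH s' (y + L)%N; first exact: leq_trans ss' sn.
    left; apply/allP => x xs; have [xl|xl] := leqP x.1 (y + L)%N.
      apply: leq_trans xl _; rewrite leq_add2l leq_pmull //.
      exact: leq_ltn_trans ss'.
    have := H x; rewrite mem_filter xl xs => /(_ isT) /leq_trans; apply.
    by rewrite -addnA leq_add2l -mulSn leq_mul2r ss' orbT.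
  right; exists x0; split; first by lia.
    apply/allP => x xs; have [xl|xl] := leqP x.1 (y + L)%N.
      by rewrite (leq_trans xl yx).
    by apply: A; rewrite mem_filter xl.
  by case/hasP: B => x; rewrite mem_filter => /andP[_ xs] xl; apply/hasP; exists x.
case: (boolP (has (fun x => y + L < x.1)%N s)) => [hs|/hasPn nh2].
  right; exists y; split=> //; apply/allP => x /nh; move: (x.1) => k; lia.
by left; apply/allP => x xs; have := nh x xs; have := nh2 x xs; move: (x.1) => k; lia.
Qed.

Lemma word_min (s : word) : s != [::] ->
  exists2 x, x \in s & all (fun y => x.1 <= y.1)%N s.
Proof.
case: s => // x0 s _.
have [|k /hasP[x xs /eqP <-] kmin] :=
    @ex_minnP (fun k => has (fun x => x.1 == k) (x0 :: s)).
  by exists x0.1; rewrite /= eqxx.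
exists x => //; apply/allP => y ys; apply: kmin; apply/hasP; by exists y.
Qed.

(** Words of diameter at most [D] are shifts of words over this finite alphabet; index 0 is allowed
    because shifts by [k > 0] make it positive. *)
Definition box (D : nat) : word :=
  [seq (k, e) | k <- iota 0 D.+1, e <- [:: true; false]].

Lemma mem_box D x : (x \in box D) = (x.1 <= D)%N.
Proof.
apply/allpairsP/idP => [[[k e] [ki _ ->]]|].
  by move: ki; rewrite mem_iota.
by case: x => k e kD; exists (k, e); split; [rewrite mem_iota | case: e {kD} | ].
Qed.

Lemma mem_letters n x : (x \in letters n) = (0 < x.1 <= n)%N.
Proof.
apply/allpairsP/idP => [[[k e] [ki _ ->]]|].
  by move: ki; rewrite mem_index_iota.
by case: x => k e kD; exists (k, e); split; [rewrite mem_index_iota | case: e {kD} | ].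
Qed.

Lemma box_uniq D : uniq (box D).
Proof. by apply: allpairs_uniq => //; [exact: iota_uniq | case=> ? ? []]. Qed.

Lemma letters_uniq n : uniq (letters n).
Proof. by apply: allpairs_uniq => //; [exact: iota_uniq | case=> ? ? []]. Qed.

Definition unshift (k : nat) : word -> word := map (fun x => ((x.1 - k)%N, x.2)).

Lemma unshiftK k s : all (fun x => k <= x.1)%N s -> word_shift k (unshift k s) = s.
Proof. by elim: s => //= x s IH /andP[kx /IH ->]; rewrite subnKC //; case: x kx. Qed.

Lemma unshift_box k D s : all (fun x => x.1 <= k + D)%N s ->
  unshift k s \in words (box D) (size s).
Proof.
move=> H; rewrite mem_words size_map eqxx all_map; apply: sub_all H => x /= xk.
by change (((x.1 - k)%N, x.2) \in box D); rewrite mem_box /= leq_subLR.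
Qed.

(** * Lower bounds for nonzero signed sums, and words of bounded diameter *)

Section GrowthBounds.
Local Open Scope classical_set_scope.
Variables (R : realType) (a : nat -> nat) (lam C : R).
Hypothesis lam_gt1 : 1 < lam.
Hypothesis a_ub : forall k, (0 < k)%N -> (a k)%:R <= C * lam ^+ k.
(** The input from the arithmetic of the roots; [word_shift_dichotomy] supplies it from
    irreducibility and dominance. *)
Hypothesis shift_dichotomy : forall s : word,
  (forall k, (0 < k)%N -> word_val a (word_shift k s) = 0) \/
  exists (delta : R) (K : nat), 0 < delta /\
    forall k, (K <= k)%N -> delta * lam ^+ k <= `|word_val a (word_shift k s)|%:~R.

Let lam_gt0 : 0 < lam. Proof. exact: lt_trans lam_gt1. Qed.

Let C_ge0 : 0 <= C.
Proof.
have := le_trans (ler0n R (a 1)) (a_ub (ltnSn 0)).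
by rewrite pmulr_lge0 // exprn_gt0.
Qed.

Lemma expr_unbounded (x : R) : exists L, x < lam ^+ L.
Proof.
have /cvgrPdist_lt/(_ (`|x| + 1)^-1) : (GRing.exp lam^-1 : R ^nat) @ \oo --> 0.
  by apply: cvg_expr; rewrite gtr0_norm ?invr_gt0 // invf_lt1.
have x1 : 0 < `|x| + 1 by rewrite ltr_wpDl.
rewrite invr_gt0 => /(_ x1) [L _ /(_ L (leqnn L))] /=.
rewrite sub0r normrN ger0_norm; last by rewrite exprn_ge0 // invr_ge0 ltW.
rewrite exprVn ltf_pV2 ?posrE ?exprn_gt0 // => xL; exists L.
apply: le_lt_trans xL; apply: le_trans (ler_norm x) _; lra.
Qed.

(** Only finitely many [k] lie below the threshold [K], and there a nonzero value, being an integer,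
    has size at least $1\ge\lambda^{k-K}$. *)
Lemma shift_lower_bound (s : word) : exists2 delta : R, 0 < delta &
  forall k, (0 < k)%N -> word_val a (word_shift k s) = 0 \/
    delta * lam ^+ k <= `|word_val a (word_shift k s)|%:~R.
Proof.
case: (shift_dichotomy s) => [H|[delta [K [d0 H]]]].
  by exists 1 => // k k0; left; exact: H.
exists (Num.min delta (lam ^- K)).
  by rewrite lt_min d0 invr_gt0 exprn_gt0.
move=> k k0; case: (eqVneq (word_val a (word_shift k s)) 0) => [->|v0]; [by left|right].
have [Kk|kK] := leqP K k.
  apply: le_trans (H k Kk); rewrite ler_pM2r ?exprn_gt0 //.
  by rewrite ge_min lexx.
apply: (@le_trans _ _ (lam ^- K * lam ^+ k)).
  by rewrite ler_pM2r ?exprn_gt0 // ge_min lexx orbT.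
apply: (@le_trans _ _ 1); last by rewrite -[1]/(1%:~R) ler_int -gtz0_ge1 normr_gt0.
by rewrite mulrC ler_pdivrMr ?exprn_gt0 // mul1r ler_eXn2l // ltnW.
Qed.

Lemma seq_shift_lower_bound (W : seq word) : exists2 delta : R, 0 < delta &
  forall s k, s \in W -> (0 < k)%N -> word_val a (word_shift k s) = 0 \/
    delta * lam ^+ k <= `|word_val a (word_shift k s)|%:~R.
Proof.
elim: W => [|s W [e e0 He]]; first by exists 1.
have [f f0 Hf] := shift_lower_bound s.
exists (Num.min e f); first by rewrite lt_min e0.
move=> t k; rewrite inE => /predU1P[->|tW] k0.
  case: (Hf k k0) => [|h]; [by left|right; apply: le_trans h].
  by rewrite ler_pM2r ?exprn_gt0 // ge_min lexx orbT.
case: (He t k tW k0) => [|h]; [by left|right; apply: le_trans h].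
by rewrite ler_pM2r ?exprn_gt0 // ge_min lexx.
Qed.

Lemma shift_eventually_stable (s : word) : exists K, forall k, (K <= k)%N ->
  (word_val a (word_shift k s) == 0) = (word_val a (word_shift k.+1 s) == 0).
Proof.
case: (shift_dichotomy s) => [H|[delta [K [d0 H]]]].
  by exists 1%N => k k0; rewrite !H.
have H' k : (K <= k)%N -> word_val a (word_shift k s) == 0 = false.
  move=> /H h; apply/negbTE/negP => /eqP v0; move: h.
  by rewrite v0 normr0 leNgt mulr_gt0 ?exprn_gt0.
by exists K => k Kk; rewrite !H' // (leq_trans Kk).
Qed.

Lemma seq_shift_stable (W : seq word) : exists K, forall s k,
    s \in W -> (K <= k)%N ->
  zero_sum a (word_shift k s) = zero_sum a (word_shift k.+1 s).
Proof.
elim: W => [|s W [K HK]]; first by exists 0%N.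
have [K' HK'] := shift_eventually_stable s.
exists (maxn K K') => t k; rewrite inE geq_max => /predU1P[->|tW] /andP[h h'].
  by rewrite /zero_sum HK'.
exact: HK.
Qed.

Lemma word_val_filterC (P : pred (nat * bool)) s :
  word_val a s = word_val a (seq.filter P s) + word_val a (seq.filter (predC P) s).
Proof. by rewrite /word_val !big_filter (bigID P). Qed.

Lemma word_val_ub (s : word) x0 : all (fun x => 0 < x.1 <= x0)%N s ->
  (`|word_val a s|%:~R : R) <= (size s)%:R * C * lam ^+ x0.
Proof.
elim: s => [|x s IH] /=; first by rewrite /word_val big_nil normr0 !mul0r.
move=> /andP[/andP[x1 x2] /IH H]; rewrite /word_val big_cons.
apply: (@le_trans _ _ (`|letter_val a x|%:~R + `|word_val a s|%:~R)).
  by rewrite -rmorphD ler_int ler_normD.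
have xb : (`|letter_val a x|%:~R : R) <= C * lam ^+ x0.
  have -> : `|letter_val a x| = (a x.1)%:Z.
    by rewrite /letter_val; case: ifP; rewrite ?normrN ger0_norm.
  apply: le_trans (a_ub x1) _; rewrite ler_wpM2l // ler_eXn2l //.
by rewrite -natr1 mulrDl mulrDl mul1r addrC lerD.
Qed.

(** Induction on the length. Words without a long gap are shifts of finitely many shapes. At a gap,
    both parts are shorter: if the upper sum vanishes, the bound for the lower part is the bound for
    the word; otherwise the upper sum outweighs the lower one. *)
Lemma word_val_lower_bound m : exists2 delta : R, 0 < delta &
  forall (s : word) y, (size s <= m)%N -> (0 < y)%N ->
    all (fun x => y <= x.1)%N s ->
  word_val a s = 0 \/ delta * lam ^+ y <= `|word_val a s|%:~R.
Proof.
elim: m => [|m [e e0 He]].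
  by exists 1 => // s y; rewrite leqn0 => /nilP -> _ _; left; rewrite /word_val big_nil.
(* With this [L] the lower part, of size at most $(m+1)C\lambda^{x_0}$, takes away at most half of
   $e\lambda^{x_0+L}$, the bound for the upper part. *)
have [L HL] := expr_unbounded (2 * m.+1%:R * C / e).
pose D := (m.+1 * L)%N.
have [f f0 Hf] := seq_shift_lower_bound
  (flatten [seq words (box D) j | j <- iota 0 m.+2]).
(* [f] serves the words without a gap, [e / 2] is what survives the subtraction of the lower
   part. *)
exists (Num.min f (e / 2)); first by rewrite lt_min f0 divr_gt0.
move=> s y sm y0 sy.
have [->|s0] := eqVneq s [::]; first by left; rewrite /word_val big_nil.
have [x xs xmin] := word_min s0.
have yx : (y <= x.1)%N by apply: (allP sy).
have [big|[x0 [xx0 gap hgap]]] := word_gap s x.1 L.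
  have sE := unshiftK xmin.
  have : unshift x.1 s \in flatten [seq words (box D) j | j <- iota 0 m.+2].
    apply/flattenP; exists (words (box D) (size s)).
      by apply: map_f; rewrite mem_iota.
    apply: unshift_box; apply: sub_all big => z /= /leq_trans; apply.
    by rewrite leq_add2l leq_mul2r sm orbT.
  move=> /(Hf _ x.1)/(_ (leq_trans y0 yx)); rewrite sE => -[|h]; [by left|right].
  apply: le_trans h; rewrite ler_pM // ?ge_min ?lexx // ?ler_eXn2l //.
    by rewrite le_min !ltW // divr_gt0.
  by rewrite exprn_ge0 // ltW.
pose P (z : nat * bool) := (z.1 <= x0)%N.
pose A := seq.filter P s; pose B := seq.filter (predC P) s.
have AB : (size A + size B)%N = size s by rewrite !size_filter count_predC.
have A0 : (0 < size A)%N by rewrite size_filter -has_count; apply/hasP; exists x.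
have B0 : (0 < size B)%N.
  rewrite size_filter -has_count; apply: sub_has hgap => z /=; rewrite /P -ltnNge.
  by apply: leq_ltn_trans; rewrite leq_addr.
have Bm : (size B <= m)%N.
  by rewrite -ltnS (leq_trans _ sm) // -AB -[ltnLHS]add0n ltn_add2r.
have Am : (size A <= m)%N.
  by rewrite -ltnS (leq_trans _ sm) // -AB -[ltnLHS]addn0 ltn_add2l.
have Bgap : all (fun z => x0 + L <= z.1)%N B.
  apply/allP => z; rewrite mem_filter /P /= => /andP[zx /(allP gap)].
  by rewrite (negbTE zx) /= => /ltnW.
have sAB := word_val_filterC P s; rewrite -/A -/B in sAB.
have x0y : (y <= x0 + L)%N by rewrite (leq_trans (leq_trans yx xx0)) // leq_addr.
have [B0'|HB] := He B (x0 + L)%N Bm (leq_trans y0 x0y) Bgap.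
  rewrite sAB B0' addr0.
  have [||h] := He A y Am y0; [|by left|right].
    by apply/allP => z; rewrite mem_filter => /andP[_ /(allP sy)].
  apply: le_trans h; rewrite ler_pM2r ?exprn_gt0 // ge_min; apply/orP; right; lra.
right.
have HA : (`|word_val a A|%:~R : R) <= e / 2 * lam ^+ (x0 + L).
  apply: (@le_trans _ _ ((size A)%:R * C * lam ^+ x0)).
    apply: word_val_ub; apply/allP => z; rewrite mem_filter => /andP[zx zs].
    by rewrite (leq_trans y0 (allP sy _ zs)).
  rewrite exprD [lam ^+ x0 * _]mulrC mulrA ler_pM2r ?exprn_gt0 //.
  move: HL; rewrite ltr_pdivrMr // => HL.
  have : (size A)%:R * C <= m.+1%:R * C.
    by rewrite ler_wpM2r // ler_nat (leq_trans Am).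
  lra.
have : e * lam ^+ (x0 + L) - `|word_val a A|%:~R <= `|word_val a s|%:~R.
  apply: (@le_trans _ _ (`|word_val a B|%:~R - `|word_val a A|%:~R)).
    by rewrite lerD2r.
  rewrite -rmorphB ler_int lerBlDr sAB.
  have := ler_normB (word_val a A + word_val a B) (word_val a A).
  by rewrite addrAC subrr add0r.
move=> h; apply: le_trans h.
apply: (@le_trans _ _ (e / 2 * lam ^+ (x0 + L))); last by lra.
rewrite ler_pM // ?ge_min ?lexx ?orbT // ?ler_eXn2l //.
  by rewrite le_min !ltW // divr_gt0.
by rewrite exprn_ge0 // ltW.
Qed.

(** A nonzero upper sum exceeds in size anything the lower part can reach, so the two cannot cancel;
    if the upper sum is zero, the total is the lower sum. *)
Lemma zero_sum_decouple m : exists L, forall (s : word) x0, (size s <= m)%N ->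
    all (fun x => 0 < x.1)%N s ->
    all (fun x => (x.1 <= x0) || (x0 + L < x.1))%N s ->
  zero_sum a s = zero_sum a [seq x <- s | (x.1 <= x0)%N] *
                 zero_sum a (seq.filter (predC (fun x => (x.1 <= x0)%N)) s).
Proof.
have [e e0 He] := word_val_lower_bound m.
have [L HL] := expr_unbounded (m%:R * C / e).
exists L => s x0 sm s0 gap.
pose P (z : nat * bool) := (z.1 <= x0)%N.
pose A := seq.filter P s; pose B := seq.filter (predC P) s.
have sAB := word_val_filterC P s; rewrite -/A -/B in sAB.
rewrite /zero_sum -/P -/A -/B sAB.
have [->|vB] := eqVneq (word_val a B) 0; first by rewrite addr0 mulr1.
rewrite mulr0; apply/eqP; rewrite pnatr_eq0 eqb0; apply/negP.
rewrite addr_eq0 => /eqP vA.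
have [|||/eqP|HB] := He B (x0 + L).+1.
- by rewrite size_filter (leq_trans (count_size _ _)).
- by [].
- apply/allP => z; rewrite mem_filter /P /= => /andP[zx /(allP gap)].
  by rewrite (negbTE zx).
- by rewrite (negbTE vB).
have : (`|word_val a A|%:~R : R) <= m%:R * C * lam ^+ x0.
  apply: (@le_trans _ _ ((size A)%:R * C * lam ^+ x0)).
    apply: word_val_ub; apply/allP => z; rewrite mem_filter => /andP[zx zs].
    by rewrite (allP s0 _ zs).
  rewrite ler_pM2r ?exprn_gt0 // ler_wpM2r // ler_nat size_filter.
  exact: leq_trans (count_size _ _) sm.
rewrite vA normrN => hA; have := le_trans HB hA; apply/negP; rewrite -ltNge.
move: HL; rewrite ltr_pdivrMr // => HL.
rewrite -addnS exprD [lam ^+ x0 * _]mulrC mulrA ltr_pM2r ?exprn_gt0 //.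
by apply: lt_le_trans HL _; rewrite mulrC ler_pM2l // ler_eXn2l.
Qed.
(** A larger diameter would force a gap of length [L]. Subwords inherit the gap, so [zero_sum]
    factors across it on all of them, and [wcum_split0] gives zero. *)
Lemma wcum_zero_sum_diam m : exists D, forall s : word, (size s <= m)%N ->
    all (fun x => 0 < x.1)%N s -> wcum (zero_sum a) s != 0 ->
  forall x y, x \in s -> y \in s -> (y.1 <= x.1 + D)%N.
Proof.
have [L HL] := zero_sum_decouple m.
exists (m * L)%N => s sm s0 Js x y xs ys.
have sn0 : s != [::] by apply: contraTneq xs => ->.
have [z zs /allP zmin] := word_min sn0.
have [/allP small|[x0 [zx0 gap hgap]]] := word_gap s z.1 L.
  apply: leq_trans (small y ys) _; rewrite leq_add ?zmin //.
  by rewrite leq_mul2r sm orbT.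
case/eqP: Js; apply: (@wcum_split0 _ _ (fun x => x.1 <= x0)%N).
- exact: zero_sum_nil.
- move=> t ts; apply: HL.
  + exact: leq_trans (size_subseq ts) sm.
  + by apply/allP => w /(mem_subseq ts) /(allP s0).
  + by apply/allP => w /(mem_subseq ts) /(allP gap).
- by apply/hasP; exists z.
- apply: sub_has hgap => w /=; rewrite -ltnNge; apply: leq_ltn_trans.
  exact: leq_addr.
Qed.

(** [wcum] reads [zero_sum] only on subwords, and these form a finite list over [box D], so one
    threshold serves all. *)
Lemma wcum_shift_stable m D : exists K, forall s k, s \in words (box D) m ->
    (K <= k)%N ->
  wcum (zero_sum a) (word_shift k s) = wcum (zero_sum a) (word_shift k.+1 s).
Proof.
have [K HK] := seq_shift_stable (flatten [seq words (box D) j | j <- iota 0 m.+1]).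
exists K => s k; rewrite mem_words => /andP[/eqP sm sD] Kk.
rewrite !wcum_map; apply: eq_wcum => t ts; apply: HK => //.
apply/flattenP; exists (words (box D) (size t)).
  by apply: map_f; rewrite mem_iota /= add0n ltnS -sm size_subseq.
by rewrite mem_words eqxx; apply/allP => x /(mem_subseq ts) /(allP sD).
Qed.

(** * Dependence of the word sums on the number of terms *)

Lemma wsum_letters_step n m (f : word -> int) :
  wsum (letters n.+1) m f = wsum (letters n) m f +
  \sum_(s <- words (letters n.+1) m | has (fun x => x.1 == n.+1) s) f s.
Proof.
rewrite /wsum (bigID (has (fun x => x.1 == n.+1))) /= addrC; congr (_ + _).
rewrite -big_filter; apply: perm_big; apply: uniq_perm.
- by rewrite filter_uniq // words_uniq // letters_uniq.
- by rewrite words_uniq // letters_uniq.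
move=> s; rewrite mem_filter !mem_words andbCA; congr (_ && _).
rewrite -all_predC -all_predI; apply: eq_all => x /=.
rewrite !mem_letters; move: (x.1) => k; lia.
Qed.

(** A contributing word that reaches [n.+1] has all its indices at least [n.+1 - D], so it is a
    shift of a word over [box D] that reaches [D]. Since [D <= n], the shift is positive and its
    results are words over [letters n.+1]. *)
Lemma wsum_letters_top D n m (f : word -> int) : (D <= n)%N ->
    (forall s, s \in words (letters n.+1) m -> f s != 0 ->
      forall x y, x \in s -> y \in s -> (y.1 <= x.1 + D)%N) ->
  \sum_(s <- words (letters n.+1) m | has (fun x => x.1 == n.+1) s) f s =
  \sum_(s <- words (box D) m | has (fun x => x.1 == D) s) f (word_shift (n.+1 - D) s).
Proof.
move=> Dn fD.
pose near (s : word) := all (fun x => n.+1 - D <= x.1)%N s.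
rewrite (bigID near) /= [X in _ + X]big1_seq ?addr0; last first.
  move=> s /andP[/andP[/hasP[y ys /eqP yn] nn] sw]; apply: contraNeq nn => fs.
  apply/allP => x xs; have := fD s sw fs x y xs ys; rewrite yn; move: (x.1) => k; lia.
transitivity (\sum_(s <- [seq word_shift (n.+1 - D) t | t <- words (box D) m] |
    has (fun x => x.1 == n.+1) s) f s); last first.
  rewrite big_map; apply: eq_bigl => s; rewrite has_map; apply: eq_has => x /=.
  move: (x.1) => k; lia.
under eq_bigl do rewrite andbC.
rewrite -big_filter_cond; apply: perm_big; apply: uniq_perm.
- by rewrite filter_uniq // words_uniq // letters_uniq.
- rewrite map_inj_uniq ?words_uniq ?box_uniq //.
  by apply: inj_map => -[x b] [y c] [/addnI -> ->].
move=> s; rewrite mem_filter mem_words; apply/idP/mapP.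
  move=> /and3P[ns /eqP <- sl]; exists (unshift (n.+1 - D) s); last by rewrite unshiftK.
  apply: unshift_box; apply: sub_all sl => x.
  rewrite mem_letters; move: (x.1) => k; lia.
move=> [t]; rewrite mem_words => /andP[tm tD] ->.
rewrite size_map tm /near !all_map; apply/andP; split.
  by apply/allP => x _ /=; rewrite leq_addr.
apply: sub_all tD => x /=; rewrite mem_box mem_letters /=; move: (x.1) => k; lia.
Qed.

Lemma wsum_wcum_zero_sum_affine m :
  exists (n1 : nat) (w b : int), forall n, (n1 < n)%N ->
  wsum (letters n) m (wcum (zero_sum a)) = w * n%:Z + b.
Proof.
have [D HD] := wcum_zero_sum_diam m.
have [K HK] := wcum_shift_stable m D.
pose U n := wsum (letters n) m (wcum (zero_sum a)).
pose w : int := \sum_(s <- words (box D) m | has (fun x => x.1 == D) s)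
  wcum (zero_sum a) (word_shift K s).
have stable s k : s \in words (box D) m ->
    wcum (zero_sum a) (word_shift (K + k) s) = wcum (zero_sum a) (word_shift K s).
  move=> sw; elim: k => [|k IH]; first by rewrite addn0.
  by rewrite addnS -HK ?leq_addr.
(* From [K + D] on, the shift [n.+1 - D] lies in the stable range, so the increment is always
   [w]. *)
have US n : (K + D <= n)%N -> U n.+1 = U n + w.
  move=> Kn; rewrite /U wsum_letters_step; congr (_ + _).
  rewrite (@wsum_letters_top D).
  - rewrite big_seq_cond [RHS]big_seq_cond; apply: eq_bigr => s /andP[sw _].
    have -> : (n.+1 - D = K + (n.+1 - D - K))%N by lia.
    exact: stable.
  - by lia.
  - move=> s; rewrite mem_words => /andP[/eqP sm sl]; apply: HD; first by rewrite sm.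
    by apply: sub_all sl => x; rewrite mem_letters => /andP[].
(* The value of [b] makes the affine formula exact at [K + D]. *)
exists (K + D)%N, w, (U (K + D)%N - w * (K + D)%N%:Z) => n Kn.
have -> : n = (K + D + (n - (K + D)))%N by lia.
elim: (n - (K + D))%N => [|k IH]; first by rewrite addn0 /U; ring.
by rewrite addnS -/(U _) US ?leq_addr // /U IH -[in RHS]addn1 PoszD; ring.
Qed.

End GrowthBounds.

(** * The dominant root *)

(** Sharing the root [x], the two polynomials are not coprime over the rationals, so the irreducible
    one divides the other. *)
Lemma irreducible_common_root (F : numFieldType) (p q : {poly int}) (x y : F) :
  irreducible_poly (map_poly (intr : int -> rat) p) ->
  root (map_poly intr p) x -> root (map_poly intr p) y ->
  root (map_poly intr q) x -> root (map_poly intr q) y.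
Proof.
have ratrE (r : {poly int}) :
    map_poly (intr : int -> F) r = map_poly (ratr : rat -> F) (map_poly intr r).
  by rewrite -map_poly_comp; apply: eq_map_poly => z /=; rewrite ratr_int.
rewrite !ratrE; set P := map_poly _ p; set Q := map_poly _ q.
move=> [_ irr] Px Py Qx.
have : ~~ coprimep P Q.
  rewrite -(coprimep_map (ratr : {rmorphism rat -> F})); apply/negP.
  by move=> /coprimep_root /(_ Px); rewrite -[_ == 0]/(root _ x) Qx.
move=> /irr/(_ (dvdp_gcdl P Q)) gP.
have PQ : P %| Q by rewrite -(eqp_dvdl _ gP) dvdp_gcdr.
apply: root_dvdp Py; by rewrite dvdp_map.
Qed.

Section DominantRoot.
Local Open Scope classical_set_scope.
Local Open Scope complex_scope.
Variables (R : realType) (d : nat) (lam : 'I_d.+1 -> R[i]).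
Local Notation r := (complex.Re (lam ord0)).
Local Notation normc := (@Normc.normc R).
Hypothesis lam1_real : lam ord0 \is Num.real.
Hypothesis lam1_gt1 : 1 < lam ord0.
Hypothesis lam1_dom : forall i : 'I_d.+1, i != ord0 -> `|lam i| < lam ord0.

Let lamE : lam ord0 = r%:C. Proof. by rewrite RRe_real. Qed.

Lemma dominant_gt1 : 1 < r.
Proof. by rewrite -ltcR -lamE. Qed.

Let r_gt0 : 0 < r. Proof. exact: lt_trans dominant_gt1. Qed.

Lemma normcE (z : R[i]) : (normc z)%:C = `|z|. Proof. by []. Qed.

Lemma normc_ge0 (z : R[i]) : 0 <= normc z.
Proof. by rewrite -lecR normcE; exact: normr_ge0. Qed.

Lemma normc_lam0 : normc (lam ord0) = r.
Proof.
apply/complexI; rewrite normcE -lamE ger0_norm // ltW //.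
exact: lt_trans lam1_gt1.
Qed.

Lemma normc_lam_lt i : i != ord0 -> normc (lam i) < r.
Proof. by move=> /lam1_dom; rewrite lamE -normcE ltcR. Qed.

Lemma normc_sum_le (I : Type) (s : seq I) (P : pred I) (F : I -> R[i]) :
  normc (\sum_(i <- s | P i) F i) <= \sum_(i <- s | P i) normc (F i).
Proof.
rewrite -lecR normcE rmorph_sum /=.
apply: le_trans (ler_norm_sum _ _ _) _; apply: ler_sum => i _.
by rewrite normcE.
Qed.

Lemma normcX (z : R[i]) k : normc (z ^+ k) = normc z ^+ k.
Proof. by apply/complexI; rewrite rmorphXn /= !normcE normrX. Qed.

(** Divided by [r ^+ k], the other terms tend to 0, so from some [K] on they take away at most half
    of the dominant one. *)
Lemma dominant_lower_bound (b : 'I_d.+1 -> R[i]) : b ord0 != 0 ->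
  exists (delta : R) (K : nat), 0 < delta /\
    forall k, (K <= k)%N -> delta * r ^+ k <= normc (\sum_i b i * lam i ^+ k).
Proof.
move=> b0.
have nb0 : 0 < normc (b ord0) by rewrite -ltcR normcE normr_gt0.
pose e k := \sum_(i | i != ord0) normc (b i) * (normc (lam i) / r) ^+ k.
have e0 : e k @[k --> \oo] --> 0.
  have cvg0 (l : seq 'I_d.+1) :
      (\sum_(i <- l | i != ord0) normc (b i) * (normc (lam i) / r) ^+ k)
        @[k --> \oo] --> 0.
    elim: l => [|i l IH]; first by under eq_fun do rewrite big_nil; exact: cvg_cst.
    have [i0|i0] := boolP (i != ord0); last first.
      by under eq_fun do rewrite big_cons (negbTE i0).
    under eq_fun do rewrite big_cons i0.
    have qi : `|normc (lam i) / r| < 1.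
      rewrite ger0_norm ?divr_ge0 ?normc_ge0 ?(ltW r_gt0) //.
      by rewrite ltr_pdivrMr // mul1r normc_lam_lt.
    have := cvgD (cvgM (cvg_cst (normc (b i))) (cvg_expr qi)) IH.
    by rewrite mulr0 addr0 => H; exact: H.
  exact: cvg0.
have /cvgrPdist_le/(_ (normc (b ord0) / 2)) := e0.
rewrite divr_gt0 // => /(_ isT) [K _ HK].
exists (normc (b ord0) / 2), K; split=> [|k Kk]; first by rewrite divr_gt0.
have := HK k Kk; rewrite /= sub0r normrN => /(le_trans (ler_norm _)) ek.
rewrite (bigD1 ord0) //=.
set t := \sum_(_ | _) _.
have tb : normc t <= e k * r ^+ k.
  apply: le_trans (normc_sum_le _ _ _) _; rewrite /e mulr_suml.
  apply: ler_sum => i _; rewrite Normc.normcM normcX expr_div_n.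
  by rewrite -!mulrA mulVf ?mulr1 // expf_neq0 // gt_eqF.
have : normc (b ord0) * r ^+ k - normc t <= normc (b ord0 * lam ord0 ^+ k + t).
  rewrite lerBlDr -normc_lam0 -normcX -Normc.normcM.
  rewrite -lecR rmorphD /= !normcE.
  by have := ler_normB (b ord0 * lam ord0 ^+ k + t) t; rewrite addrK.
apply: le_trans; rewrite lerBrDr.
apply: le_trans (_ : _ <= normc (b ord0) / 2 * r ^+ k + e k * r ^+ k) _.
  by rewrite lerD2l.
rewrite -mulrDl ler_pM2r ?exprn_gt0 //; lra.
Qed.

Section Sequence.
Variables (c : 'I_d.+1 -> R[i]) (p : {poly int}) (a : nat -> nat).
Hypothesis p_irr : irreducible_poly (map_poly (intr : int -> rat) p).
Hypothesis p_roots : map_poly (intr : int -> R[i]) p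
             = (lead_coef p)%:~R *: \prod_(i < d.+1) ('X - (lam i)%:P).
Hypothesis c1_neq0 : c ord0 != 0.
Hypothesis a_def : forall k : nat, (0 < k)%N ->
           ((a k)%:R : R[i]) = \sum_(i < d.+1) c i * lam i ^+ k.

Lemma seq_upper_bound k : (0 < k)%N ->
  (a k)%:R <= (\sum_i normc (c i)) * r ^+ k.
Proof.
move=> k0.
have -> : ((a k)%:R : R) = normc (a k)%:R.
  by apply/complexI; rewrite normcE normr_nat rmorph_nat.
rewrite a_def //; apply: le_trans (normc_sum_le _ _ _) _.
rewrite mulr_suml; apply: ler_sum => i _; rewrite Normc.normcM normcX.
rewrite ler_wpM2l ?normc_ge0 // lerXn2r ?nnegrE ?normc_ge0 ?(ltW r_gt0) //.
by have [->|/normc_lam_lt/ltW//] := eqVneq i ord0; rewrite normc_lam0.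
Qed.

(** Indices become exponents, so a shift by [k] multiplies the value at [lam i] by [lam i ^+ k]. *)
Definition word_poly (s : word) : {poly int} :=
  \sum_(x <- s) (if x.2 then 1 else -1) *: 'X^(x.1).

Lemma word_val_shift s k : (0 < k)%N ->
  (word_val a (word_shift k s))%:~R =
  \sum_i (c i * (map_poly intr (word_poly s)).[lam i]) * lam i ^+ k.
Proof.
move=> k0; elim: s => [|x s IH].
  rewrite /word_val /word_poly !big_nil /=.
  by rewrite big1 // => i _; rewrite rmorph0 horner0 mulr0 mul0r.
rewrite /word_val /= big_cons rmorphD /= -/(word_val a (word_shift k s)) IH.
rewrite /word_poly big_cons -/(word_poly s).
rewrite (_ : (letter_val a _)%:~R =
  \sum_i (c i * ((if x.2 then 1 else -1) * lam i ^+ x.1)) * lam i ^+ k).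
  rewrite -big_split /=; apply: eq_bigr => i _.
  rewrite rmorphD /= hornerD mulrDr mulrDl; congr (_ * _ + _); congr (_ * _).
  rewrite map_polyZ hornerZ map_polyXn hornerXn; congr (_ * _).
  by case: (x.2); rewrite ?rmorphN rmorph1.
rewrite /letter_val /=; case: (x.2).
  rewrite -pmulrn a_def ?addn_gt0 ?k0 //; apply: eq_bigr => i _; rewrite exprD; ring.
rewrite rmorphN /= -pmulrn a_def ?addn_gt0 ?k0 // -sumrN.
apply: eq_bigr => i _; rewrite exprD; ring.
Qed.

(** If [word_poly s] vanishes at the dominant root, it vanishes at every root and all coefficients
    in [word_val_shift] are zero. Otherwise the dominant coefficient is nonzero and
    [dominant_lower_bound] applies. *)
Lemma word_shift_dichotomy (s : word) :
  (forall k, (0 < k)%N -> word_val a (word_shift k s) = 0) \/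
  exists (delta : R) (K : nat), 0 < delta /\
    forall k, (K <= k)%N -> delta * r ^+ k <= `|word_val a (word_shift k s)|%:~R.
Proof.
have proot i : root (map_poly intr p) (lam i).
  rewrite p_roots /root hornerZ horner_prod (bigD1 i) //= hornerXsubC subrr.
  by rewrite mul0r mulr0.
case: (boolP (root (map_poly intr (word_poly s)) (lam ord0))) => [q0|q0].
  left=> k k0; apply/eqP; rewrite -(intr_eq0 R[i]) word_val_shift //; apply/eqP.
  apply: big1 => i _.
  have /eqP -> := irreducible_common_root p_irr (proot ord0) (proot i) q0.
  by rewrite mulr0 mul0r.
right.
have [|delta [K [d0 H]]] := @dominant_lower_bound
  (fun i => c i * (map_poly intr (word_poly s)).[lam i]).
  by rewrite mulf_neq0.
(* [K.+1] instead of [K] makes [k] positive, as [word_val_shift] demands. *)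
exists delta, K.+1; split=> // k Kk.
apply: le_trans (H k (ltnW Kk)) _; rewrite -word_val_shift ?(leq_trans _ Kk) //.
by rewrite -lecR normcE rmorph_int intr_norm.
Qed.

End Sequence.
End DominantRoot.

Theorem theoremC (R : realType) (d : nat) (lam c : 'I_d.+1 -> R[i])
  (p : {poly int})
  (p_irr : irreducible_poly (map_poly (intr : int -> rat) p))
  (p_roots : map_poly (intr : int -> R[i]) p
             = (lead_coef p)%:~R *: \prod_(i < d.+1) ('X - (lam i)%:P))
  (lam1_real : lam ord0 \is Num.real)
  (lam1_gt1 : 1 < lam ord0)
  (lam1_dom : forall i : 'I_d.+1, i != ord0 -> `|lam i| < lam ord0)
  (c1_neq0 : c ord0 != 0)
  (a : nat -> nat)
  (a_pos : forall k : nat, (0 < k)%N -> (0 < a k)%N)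
  (a_def : forall k : nat, (0 < k)%N ->
           ((a k)%:R : R[i]) = \sum_(i < d.+1) c i * lam i ^+ k) :
  forall m : nat, exists (n1 : nat) (w b : int),
    forall n : nat, (n1 < n)%N ->
      cumulant m (Ssum (R := R) a n) = 2%:R ^- m * ((w * n%:Z + b)%:~R).
Proof.
case=> [|m].
  (* The word formula starts with the first cumulant; the zeroth is $\log 1=0$. *)
  exists 0%N, 0, 0 => n _; rewrite mul0r addr0 mulr0.
  exact: cumulant0.
have [n1 [w [b H]]] := wsum_wcum_zero_sum_affine (dominant_gt1 lam1_real lam1_gt1)
  (seq_upper_bound lam1_real lam1_gt1 lam1_dom a_def)
  (word_shift_dichotomy lam1_real lam1_gt1 lam1_dom p_irr p_roots c1_neq0 a_def) m.+1.
by exists n1, w, b => n /H <-; exact: cumulant_Ssum.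
Qed.
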